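(* Let $X=\{X(t),\,t\in\mathcal{T}\}$ be a multifractal process with set of scales $\Lambda$, set $\mathcal{S}$ and family of scaling factors $\{M(\lambda,t),\,\lambda\in\Lambda,\,t\in\mathcal{S}\}$. Suppose $\overline{q}(X)>0$ and that for some $t\in\mathcal{S}$ (and hence for every $t\in\mathcal{S}$) the process $\{M(\lambda,t),\,\lambda\in\Lambda\}$ is continuous in law. Let $\{L(s),\,s\ge0\}$ be a Lévy process such that $$L(1)\overset{d}{=}\begin{cases}\log M(e^{-1},t), & \text{if }\Lambda=(0,1],\\ \log M(e,t), & \text{if }\Lambda=[1,\infty).\end{cases}$$ Then for every $s\ge0$, $$L(s)\overset{d}{=}\log M(e^{-s},t)\quad\text{if }\Lambda=(0,1],$$ and $$L(s)\overset{d}{=}\log M(e^{s},t)\quad\text{if }\Lambda=[1,\infty).$$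
   Context: All processes are real-valued. $\overset{d}{=}$ denotes equality in law, and $\{\cdot\}\overset{d}{=}\{\cdot\}$ equality of finite dimensional distributions. The time set $\mathcal{T}$ is one of $(0,\infty)$, $[0,\infty)$, $(0,T]$, $[0,T]$, $[T,\infty)$ with $T>0$. Every process is assumed not identically null: there is $t\in\mathcal{T}$, $t\neq0$, with $P(X(t)\neq0)>0$. A process $X=\{X(t),\,t\in\mathcal{T}\}$ is multifractal (with sets $\Lambda\subset(0,\infty)$, $\mathcal{S}\subset\mathcal{T}$) if for every $\lambda\in\Lambda$ there exists a family of identically distributed positive random variables $\{M(\lambda,t),\,t\in\mathcal{S}\}$, independent of the process $\{X(t)\}$, such that $\{X(\lambda t)\}_{t\in\mathcal{S}}\overset{d}{=}\{M(\lambda,t)X(t)\}_{t\in\mathcal{S}}$. The random field $M=\{M(\lambda,t),\,\lambda\in\Lambda,\,t\in\mathcal{S}\}$ is called the family of scaling factors. Standing assumption: either $\Lambda=(0,1]$ or $\Lambda=[1,\infty)$, and $\lambda\mathcal{S}=\{\lambda t:t\in\mathcal{S}\}\subset\mathcal{S}$ for every $\lambda\in\Lambda$. $\overline{q}(X)=\sup\{q\ge0:\ \mathbb{E}|X(t)|^q<\infty\text{ for all }t\in\mathcal{T}\}$. A process $\{Z(\lambda)\}$ is continuous in law if for every $\lambda_0$, $Z(\lambda)\to Z(\lambda_0)$ in distribution as $\lambda\to\lambda_0$. A Lévy process is a process starting at zero, with stationary independent increments, and stochastically continuous.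
   Formalization: It is additionally assumed that X is not null on S (some t in S has P(X(t)≠0)>0), not only on the time set; otherwise the scaling identity says nothing about M and the claim fails, e.g. X=0 on S=(0,1], X=1 on (1,∞), M(λ,t)=e^{λ-1}. *)

(* Defs.v *)
From HB Require Import structures.
From mathcomp Require Import all_boot all_order all_algebra.
From mathcomp Require Import all_classical all_reals all_analysis.

Set Implicit Arguments.
Unset Strict Implicit.
Unset Printing Implicit Defensive.

Import Order.TTheory GRing.Theory Num.Theory.
Import numFieldNormedType.Exports.

Local Open Scope classical_set_scope.
Local Open Scope ring_scope.

(* A process indexed by I : set R is a function on all of R whose values
   outside I are irrelevant: every notion below only looks at indices in I. *)

Definition time_set (R : realType) (T : set R) : Prop :=
  T = `]0, +oo[%classic \/
  T = `[0, +oo[%classic \/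
  exists2 T0 : R, 0 < T0 &
    [\/ T = `]0, T0]%classic, T = `[0, T0]%classic | T = `[T0, +oo[%classic].

Definition eq_law d1 d2 d (Om1 : measurableType d1) (Om2 : measurableType d2)
    (E : measurableType d) (R : realType)
    (P1 : probability Om1 R) (Y1 : Om1 -> E)
    (P2 : probability Om2 R) (Y2 : Om2 -> E) : Prop :=
  forall A : set E, measurable A -> pushforward P1 Y1 A = pushforward P2 Y2 A.

(* n.-tuple R carries the product sigma-algebra. *)
Definition eq_fdd d (Om : measurableType d) (R : realType)
    (P : probability Om R) (I : set R) (Y Z : R -> Om -> R) : Prop :=
  forall (n : nat) (t : n.-tuple R), (forall i, I (tnth t i)) ->
    eq_law P (fun w => [tuple Y (tnth t i) w | i < n])
           P (fun w => [tuple Z (tnth t i) w | i < n]).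

Definition sigma_process (Om : Type) (R : realType)
    (I : set R) (Y : R -> Om -> R) : set (set Om) :=
  <<s [set A | exists2 t, I t &
         exists2 B : set R, measurable B & A = Y t @^-1` B] >>.

Definition independent_processes d (Om : measurableType d) (R : realType)
    (P : probability Om R) (I : set R) (Y : R -> Om -> R)
    (J : set R) (Z : R -> Om -> R) : Prop :=
  forall A B, sigma_process I Y A -> sigma_process J Z B ->
    P (A `&` B) = (P A * P B)%E.

Definition not_identically_null d (Om : measurableType d) (R : realType)
    (P : probability Om R) (T : set R) (X : R -> Om -> R) : Prop :=
  exists t : R, [/\ T t, t != 0 & (0 < P [set w | X t w != 0%R])%E].

(* Positivity of a scaling factor is almost sure positivity. *)
Definition multifractal d (Om : measurableType d) (R : realType)
    (P : probability Om R) (T Lambda S : set R)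
    (X : R -> {RV P >-> R}) (M : R -> R -> {RV P >-> R}) : Prop :=
  forall l, Lambda l ->
    [/\ forall t, S t -> P [set w | 0 < M l t w] = 1%E,
        forall t u, S t -> S u -> eq_law P (M l t) P (M l u),
        independent_processes P S (M l) T X &
        eq_fdd P S (fun t => X (l * t)) (fun t w => M l t w * X t w)].

Definition qbar d (Om : measurableType d) (R : realType)
    (P : probability Om R) (T : set R) (X : R -> Om -> R) : \bar R :=
  ereal_sup [set q%:E | q in [set q : R | 0 <= q /\
    forall t, T t -> ('E_P[fun w => (`|X t w| `^ q)%R] < +oo)%E]].

(* Convergence in distribution is tested on bounded continuous functions. *)
Definition continuous_in_law d (Om : measurableType d) (R : realType)
    (P : probability Om R) (I : set R) (Z : R -> Om -> R) : Prop :=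
  forall l0 : R, I l0 ->
  forall f : R -> R, continuous f -> (exists K : R, forall x, `|f x| <= K) ->
    ('E_P[f \o Z l] @[l --> within I (nbhs l0)] --> 'E_P[f \o Z l0])%E.

Definition stationary_increments d (Om : measurableType d) (R : realType)
    (P : probability Om R) (L : R -> Om -> R) : Prop :=
  forall s h : R, 0 <= s -> 0 <= h ->
    eq_law P (L (s + h) \- L s) P (L h \- L 0).

Definition independent_increments d (Om : measurableType d) (R : realType)
    (P : probability Om R) (L : R -> Om -> R) : Prop :=
  forall (n : nat) (s : nat -> R), 0 <= s 0%N ->
    (forall i, (i < n)%N -> s i < s i.+1) ->
  forall A : 'I_n -> set R, (forall i, measurable (A i)) ->
    P (\bigcap_(i in [set: 'I_n]) (L (s i.+1) \- L (s i)) @^-1` A i) =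
    (\prod_(i < n) P ((L (s i.+1) \- L (s i))%R @^-1` A i))%E.

Definition stochastically_continuous d (Om : measurableType d) (R : realType)
    (P : probability Om R) (L : R -> Om -> R) : Prop :=
  forall s : R, 0 <= s -> forall e : R, 0 < e ->
    P [set w | e < `|L u w - L s w|]
      @[u --> within `[0, +oo[%classic (nbhs s)] --> 0%E.

Definition levy_process d (Om : measurableType d) (R : realType)
    (P : probability Om R) (L : R -> {RV P >-> R}) : Prop :=
  [/\ P [set w | L 0 w = 0] = 1%E,
      stationary_increments P L,
      independent_increments P L &
      stochastically_continuous P L].

(* Main.v *)
From HB Require Import structures.
Require Import Defs.
From mathcomp Require Import all_boot all_order all_algebra.
From mathcomp Require Import all_classical all_reals all_analysis.
From mathcomp Require Import measurable_realfun.
From mathcomp Require Import ring lra.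
Import Order.TTheory GRing.Theory Num.Theory.
Import numFieldNormedType.Exports.
Local Open Scope classical_set_scope.
Local Open Scope ring_scope.

Set Implicit Arguments.
Unset Strict Implicit.
Unset Printing Implicit Defensive.

(** Fix [t0] in [S] where [X t0] is not almost surely zero, and a small [q > 0].
    The moment [E|X t0|^q] is finite because [qbar > 0], and it is positive.
    Independence of [M l] and [X] gives [E|X (l t)|^q = E (M l)^q * E|X t|^q],
    so applying the scaling relation once with [l m], or twice with [m] and
    then [l], and dividing by [E|X t0|^q], yields

      [E (M (l m))^q = E (M l)^q * E (M m)^q < +oo]

    ([scaling_abs_moment], [log_factor_mgfM]).  Thus, along [l = e^s] or
    [l = e^(-s)], the moment generating function [phi_q(s)] of
    [N s = ln (M l t)] at [q] is multiplicative in [s].  The same holds for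
    [psi_q(s) = E e^(q L(s))] because increments are independent and stationary
    ([levy_mgfD]).  By hypothesis [phi_q(1) = psi_q(1)]; as nonnegative [n]-th
    roots are unique, [phi_q] and [psi_q] agree at all positive rationals, for
    every [q] in some interval [(0, q0)].

    A moment generating function that is finite on an interval to the right of
    the origin determines the law ([eq_law_mgf]), so [L s] and [N s] have the
    same law for rational [s > 0].  For real [s >= 0] both sides are limits
    along positive rationals: the laws of [L s] by stochastic continuity
    ([levy_ramp_cvg]), those of [N s] by continuity in law of [M]
    ([log_factor_ramp_cvg]).

    The uniqueness theorem [eq_law_mgf] is proved by real methods.  Put
    [2 a = q0] and compare the two laws through integrals of functions weighted
    by [e^(a z)].  Difference quotients in the exponent show that
    [z^n e^(a z)] has the same integral under both laws; expanding in power
    series, the same follows after multiplication by [sin (b z)] with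
    [0 <= b < a], any number of times.  Polynomials in [sin (b z)] converge
    boundedly to the sign of [sin (b z)], which in turn converges to the sign
    of [z] as [b] tends to [0].  The weight is then removed by one more power
    series, the one of [e^(- c z)] for [c < a], and the limit [c --> a].  So
    [P (Z > 0)] is the same for both laws, and shifting [Z] gives
    [P (Z > x)]. *)

(** * Elementary real analysis *)

Lemma expRB1_bounds (R : realType) (x : R) : x <= expR x - 1 <= x * expR x.
Proof.
apply/andP; split; first by have := expR_ge1Dx x; lra.
have := expR_ge1Dx (- x); rewrite expRN => h.
have e0 := expR_gt0 x.
have : (1 - x) * expR x <= (expR x)^-1 * expR x by rewrite ler_pM2r.
by rewrite mulVf ?gt_eqF//; lra.
Qed.

(** Both bounds hold for either sign of [z] and tend to [z] as [e] tends to [0],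
    so the difference quotient converges by squeezing. *)
Lemma expR_diffquot_bounds (R : realType) (e z : R) : 0 < e ->
  z <= e^-1 * (expR (e * z) - 1) <= z * expR (e * z).
Proof.
move=> e0; have /andP[h1 h2] := expRB1_bounds (e * z).
by rewrite mulrC ler_pdivlMr// ler_pdivrMr// mulrC h1 mulrAC [z * e]mulrC.
Qed.

Lemma expR_diffquot_le (R : realType) (e z : R) : 0 < e ->
  `|e^-1 * (expR (e * z) - 1)| <= `|z| * expR (e * `|z|).
Proof.
move=> e0; have /andP[h1 h2] := expR_diffquot_bounds z e0.
have z0 : `|z| <= `|z| * expR (e * `|z|).
  by rewrite ler_peMr// -{1}expR0 ler_expR mulr_ge0// ltW.
rewrite ler_norml; apply/andP; split.
  apply: le_trans h1; rewrite lerNl; apply: le_trans z0; rewrite -normrN.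
  exact: ler_norm.
apply: (le_trans h2); apply: (@le_trans _ _ (`|z| * expR (e * z))).
  by rewrite ler_wpM2r// ?expR_ge0// ler_norm.
by rewrite ler_wpM2l// ler_expR ler_wpM2l// ?ler_norm// ltW.
Qed.

Lemma expR_diffquot_cvg (R : realType) (r z : R) : 0 < r ->
  (r / k.+1%:R)^-1 * (expR (r / k.+1%:R * z) - 1) @[k --> \oo] --> z.
Proof.
move=> r0; apply: (@squeeze_cvgr _ _ _ _ (cst z)
  (fun k => z * expR (r / k.+1%:R * z))).
- by near=> k; apply: expR_diffquot_bounds; rewrite divr_gt0.
- exact: cvg_cst.
- rewrite -[X in _ --> X]mulr1; apply: cvgMr; rewrite -[X in _ --> X]expR0.
  apply: continuous_cvg; first exact: continuous_expR.
  rewrite -[X in _ --> X](mul0r z); apply: cvgMl.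
  rewrite -[X in _ --> X](mulr0 r); apply: cvgMr.
  exact: cvg_harmonic.
Unshelve. all: by end_near. Qed.

(** A power is absorbed by an arbitrarily small increase of the exponential
    rate, since [|z| <= expR (e * |z|) / e] for every [e > 0].  The sum
    on the right combines functions [expR (q * z)], whose integrals are
    given by the moment generating function. *)
Lemma normX_expR_le (R : realType) (n : nat) (b b' : R) : b < b' ->
  exists2 C : R, 0 <= C & forall z : R,
    `|z| ^+ n * expR (b * `|z|) <= C * (expR (b' * z) + expR (- b' * z)).
Proof.
move=> bb'; pose e := (b' - b) / n.+1%:R.
have e0 : 0 < e by rewrite divr_gt0// subr_gt0.
exists (e^-1 ^+ n) => [|z]; first by rewrite exprn_ge0// invr_ge0 ltW.
have z1 : `|z| <= e^-1 * expR (e * `|z|).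
  rewrite -[leLHS](mulKf (lt0r_neq0 e0)) ler_pM2l ?invr_gt0//.
  by have := expR_ge1Dx (e * `|z|); lra.
have z2 : `|z| ^+ n <= (e^-1 * expR (e * `|z|)) ^+ n.
  by rewrite lerXn2r ?nnegrE// (le_trans _ z1).
apply: (@le_trans _ _ (e^-1 ^+ n * expR (b' * `|z|))).
  rewrite exprMn in z2; apply: (@le_trans _ _
    (e^-1 ^+ n * (expR (e * `|z|) ^+ n * expR (b * `|z|)))).
    by rewrite mulrA ler_wpM2r// expR_ge0.
  rewrite ler_wpM2l ?exprn_ge0 ?invr_ge0 ?(ltW e0)//.
  rewrite -expRM_natl -expRD ler_expR mulrA -mulrDl ler_wpM2r//.
  have ne : n.+1%:R * e = b' - b by rewrite /e mulrC divfK.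
  by rewrite mulrSr mulrDl mul1r in ne; lra.
rewrite ler_wpM2l ?exprn_ge0 ?invr_ge0 ?(ltW e0)//.
have [z0|z0] := leP 0 z; first by rewrite ger0_norm// lerDl expR_ge0.
by rewrite ltr0_norm// mulrN mulNr lerDr expR_ge0.
Qed.

Lemma norm_power_series_le (R : realType) (c : nat -> R) (b z : R) (N : nat) :
  0 <= b -> (forall k, `|c k| <= b ^+ k / k`!%:R) ->
  `|\sum_(0 <= k < N) c k * z ^+ k| <= expR (b * `|z|).
Proof.
move=> b0 cb; apply: (le_trans (ler_norm_sum _ _ _)).
apply: (@le_trans _ _ (series (exp_coeff (b * `|z|)) N)).
  apply: ler_sum => k _; rewrite /exp_coeff /= normrM normrX exprMn mulrAC.
  by rewrite ler_wpM2r// exprn_ge0.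
apply: nondecreasing_cvgn_le; last exact: is_cvg_series_exp_coeff.
by apply: nondecreasing_series => n _ _; rewrite exp_coeff_ge0// mulr_ge0.
Qed.

(** Its iterates converge to the sign function on [[-1, 1]]: it is odd, maps
    [[-1, 1]] to itself and has [1] as an attracting fixed point.  Being
    polynomial, it preserves any algebra of functions. *)
Definition sharpen (R : realType) (x : R) : R := (3 * x - x ^+ 3) / 2.

Lemma cvg_iter_sharpen (R : realType) (x : R) : `|x| <= 1 ->
  iter k (@sharpen R) x @[k --> \oo] --> Num.sg x.
Proof.
have pos (y : R) : 0 < y <= 1 -> iter k (@sharpen R) y @[k --> \oo] --> (1 : R).
  move=> /andP[y0 y1].
  (* [1 - sharpen v = (1 - v) * ((1 - v) * (2 + v) / 2)], and the last factor is
     at most [1 - y / 2] once [v >= y]: the distance to [1] decays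
     geometrically. *)
  have H k : y <= iter k (@sharpen R) y <= 1 /\
             1 - iter k (@sharpen R) y <= (1 - y / 2) ^+ k.
    elim: k => [|k [/andP[l u] e]]; first by rewrite expr0 /=; split; lra.
    rewrite iterS exprS; move: (iter k _ y) l u e => v l u e.
    have e1 : (1 - v) * ((1 - v) * (2 + v) / 2) = 1 - sharpen v.
      by rewrite /sharpen; field.
    have v2 : 0 <= (1 - v) * (2 + v) / 2 by rewrite divr_ge0// mulr_ge0; lra.
    have v3 : (1 - v) * (2 + v) / 2 <= 1 - y / 2 by nra.
    have p1 : 0 <= (1 - v) * ((1 - v) * (2 + v) / 2).
      by rewrite mulr_ge0 // subr_ge0.
    have p2 : v <= sharpen v by rewrite /sharpen; nra.
    split; first by apply/andP; split; lra.
    rewrite -e1 mulrC; apply: ler_pM => //; lra.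
  apply: (@squeeze_cvgr _ _ _ _ (fun k => 1 - (1 - y / 2) ^+ k) (cst 1)).
  - by apply: nearW => k; have [/andP[_ u] e] := H k; rewrite u andbT; lra.
  - rewrite -[X in _ --> X]subr0; apply: cvgB; first exact: cvg_cst.
    by apply: cvg_expr; rewrite ger0_norm; lra.
  - exact: cvg_cst.
have odd_iter (y : R) k : iter k (@sharpen R) (- y) = - iter k (@sharpen R) y.
  by elim: k => // k IH; rewrite !iterS IH /sharpen; field.
move=> x1; have [x0|x0|->] := ltgtP x 0.
- rewrite ltr0_sg// -[x]opprK; under eq_fun do rewrite odd_iter.
  by apply: cvgN; apply: pos; rewrite oppr_gt0 x0 -(ltr0_norm x0).
- by rewrite gtr0_sg//; apply: pos; rewrite x0 -(gtr0_norm x0).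
- have -> : (fun k => iter k (@sharpen R) 0) = cst 0.
    apply/funext => k /=; elim: k => // k IH.
    by rewrite iterS IH /sharpen expr0n /= mulr0 subr0 mul0r.
  by rewrite sgr0; exact: cvg_cst.
Qed.

Section ramp.
Context (R : realType).
Implicit Types n x y z : R.

(** The Lipschitz function equal to [0] up to [x], to [1] from [x + 1 / n] on,
    and affine in between, for [n > 0].  It is written with absolute values,
    rather than with minima and maxima, so that the bounds, the continuity and
    the Lipschitz constant come from the triangle inequality. *)
Definition ramp n x z : R := (1 + `|n * (z - x)| - `|n * (z - x) - 1|) / 2.

Lemma ramp_ge0 n x z : 0 <= ramp n x z.
Proof.
rewrite divr_ge0//; have := ler_normB (n * (z - x)) 1.
have := ler_distD 0 1 (n * (z - x)).
by rewrite subr0 sub0r normrN normr1 distrC; lra.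
Qed.

Lemma ramp_le1 n x z : ramp n x z <= 1.
Proof.
rewrite ler_pdivrMr// mul1r.
have := ler_distD 1 (n * (z - x)) 0; rewrite !subr0 normr1; lra.
Qed.

Lemma ramp_eq0 n x z : 0 <= n -> z <= x -> ramp n x z = 0.
Proof.
move=> n0 zx; rewrite /ramp; have y0 : n * (z - x) <= 0.
  by rewrite mulr_ge0_le0// subr_le0.
by rewrite (ler0_norm y0) ler0_norm; lra.
Qed.

Lemma ramp_eq1 n x z : 1 <= n * (z - x) -> ramp n x z = 1.
Proof.
by move=> y1; rewrite /ramp ger0_norm ?ger0_norm; lra.
Qed.

Lemma ramp_lipschitz n x y z : 0 <= n ->
  `|ramp n x y - ramp n x z| <= n * `|y - z|.
Proof.
move=> n0; pose u := n * (y - x); pose v := n * (z - x).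
have -> : n * `|y - z| = `|u - v|.
  rewrite -[X in X * _](ger0_norm n0) -normrM; congr `|_|.
  by rewrite /u /v; ring.
have -> : ramp n x y - ramp n x z =
   ((`|u| - `|v|) + (`|v - 1| - `|u - 1|)) / 2.
  by rewrite /ramp /u /v; field.
have h1 := ler_dist_dist u v; have h2 := ler_dist_dist (v - 1) (u - 1).
have e : v - 1 - (u - 1) = - (u - v) by ring.
rewrite e normrN in h2.
rewrite normrM [`|2^-1|]ger0_norm// ler_pdivrMr//.
by apply: (le_trans (ler_normD _ _)); lra.
Qed.

Lemma ramp_continuous n x : continuous (ramp n x).
Proof.
move=> z; rewrite /ramp; apply: cvgMl; apply: cvgB; last first.
  apply: cvg_norm; apply: cvgB; last exact: cvg_cst.
  by apply: cvgMr; apply: cvgB; [exact: cvg_id|exact: cvg_cst].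
apply: cvgD; first exact: cvg_cst.
apply: cvg_norm.
by apply: cvgMr; apply: cvgB; [exact: cvg_id|exact: cvg_cst].
Qed.

Lemma measurable_ramp n x : measurable_fun setT (ramp n x).
Proof. by apply: continuous_measurable_fun; exact: ramp_continuous. Qed.

Lemma ramp_cvg x z : ramp k%:R x z @[k --> \oo] --> ((x < z)%R%:R : R).
Proof.
have [xz|zx] := ltP x z; last first.
  by under eq_fun do rewrite ramp_eq0//; exact: cvg_cst.
apply: cvg_near_cst; near=> k; apply: ramp_eq1.
rewrite -ler_pdivrMr ?subr_gt0//; near: k; exact: nbhs_infty_ger.
Unshelve. all: by end_near. Qed.

End ramp.

(** * Laws and integrals of random variables *)

Section law_and_integral.
Context d (T : measurableType d) (R : realType) (P : probability T R).

Lemma measurable_gt_set (Z : T -> R) x : measurable_fun setT Z ->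
  measurable [set w | x < Z w].
Proof.
move=> mZ; rewrite -[X in measurable X]setTI.
have -> : [set w | x < Z w] = Z @^-1` `]x, +oo[%classic.
  by apply/seteqP; split=> w /=; rewrite in_itv /= andbT.
exact: mZ.
Qed.

Lemma probability1_ae (A : set T) : measurable A -> P A = 1%E ->
  {ae P, forall w, A w}.
Proof.
move=> mA A1; exists (~` A); split => //; first exact: measurableC.
by rewrite probability_setC// A1 subee.
Qed.

Lemma ae_integral_eq (f g : T -> R) :
  measurable_fun setT f -> measurable_fun setT g ->
  (forall w, 0 <= f w) -> (forall w, 0 <= g w) ->
  {ae P, forall w, f w = g w} ->
  (\int[P]_w (f w)%:E = \int[P]_w (g w)%:E)%E.
Proof.
move=> mf mg f0 g0 fg; apply: ge0_ae_eq_integral => //.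
- exact/measurable_EFinP.
- exact/measurable_EFinP.
- by move=> w _; rewrite lee_fin.
- by move=> w _; rewrite lee_fin.
- by apply: filterS fg => w -> _.
Qed.

Lemma eq_law_integral d' (T' : measurableType d') (P' : probability T' R)
    (Y : T -> R) (Y' : T' -> R) (f : R -> R) :
  measurable_fun setT Y -> measurable_fun setT Y' ->
  measurable_fun setT f -> (forall y, 0 <= f y) ->
  eq_law P Y P' Y' ->
  (\int[P]_w (f (Y w))%:E = \int[P']_w (f (Y' w))%:E)%E.
Proof.
move=> mY mY' mf f0 YY'.
pose X : {RV P >-> R} := HB.pack Y (isMeasurableFun.Build _ _ _ _ Y mY).
pose X' : {RV P' >-> R} := HB.pack Y' (isMeasurableFun.Build _ _ _ _ Y' mY').
have mEf : measurable_fun setT (EFin \o f) by exact/measurable_EFinP.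
have Ef0 y : (0 <= (EFin \o f) y)%E by rewrite lee_fin.
have := ge0_integral_distribution X mEf Ef0.
have := ge0_integral_distribution X' mEf Ef0.
rewrite /= => <- <-; apply: eq_measure_integral => A mA _; exact: YY'.
Qed.

(** The product rule on rectangles says that the joint law is the product of
    the marginal laws; Tonelli's theorem then factors the integral. *)
Lemma integral_indepM (U V : T -> R) (f g : R -> R) :
  measurable_fun setT U -> measurable_fun setT V ->
  measurable_fun setT f -> measurable_fun setT g ->
  (forall y, 0 <= f y) -> (forall y, 0 <= g y) ->
  (forall A B : set R, measurable A -> measurable B ->
    P (U @^-1` A `&` V @^-1` B) = (P (U @^-1` A) * P (V @^-1` B))%E) ->
  (\int[P]_w (f (U w) * g (V w))%:E =
   (\int[P]_w (f (U w))%:E) * (\int[P]_w (g (V w))%:E))%E.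
Proof.
move=> mU mV mf mg f0 g0 UV.
pose X : {RV P >-> R} := HB.pack U (isMeasurableFun.Build _ _ _ _ U mU).
pose Y : {RV P >-> R} := HB.pack V (isMeasurableFun.Build _ _ _ _ V mV).
pose XY w := (U w, V w).
have mXY : measurable_fun setT XY by exact: measurable_fun_pair.
pose Z : {RV P >-> (R * R)%type} :=
  HB.pack XY (isMeasurableFun.Build _ _ _ _ XY mXY).
have mEf : measurable_fun setT (EFin \o f) by exact/measurable_EFinP.
have mEg : measurable_fun setT (EFin \o g) by exact/measurable_EFinP.
have Ef0 y : (0 <= (EFin \o f) y)%E by rewrite lee_fin.
have Eg0 y : (0 <= (EFin \o g) y)%E by rewrite lee_fin.
pose h (z : R * R) : \bar R := (f z.1 * g z.2)%:E.
have mh : measurable_fun setT h.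
  apply/measurable_EFinP; apply: measurable_funM.
    exact: (measurableT_comp mf measurable_fst).
  exact: (measurableT_comp mg measurable_snd).
have h0 z : (0 <= h z)%E by rewrite lee_fin mulr_ge0.
rewrite -(ge0_integral_distribution Z mh h0).
rewrite -(ge0_integral_distribution X mEf Ef0).
rewrite -(ge0_integral_distribution Y mEg Eg0).
transitivity (\int[distribution P X \x distribution P Y]_z h z)%E.
  apply: eq_measure_integral => A mA _; apply/esym.
  by apply: product_measure_unique => // B C mB mC; exact: UV.
rewrite fubini_tonelli1//.
rewrite -ge0_integralZr//; last exact: integral_ge0.
apply: eq_integral => x _; rewrite /fubini_F /h /=.
under eq_integral do rewrite EFinM.
by rewrite ge0_integralZl_EFin// => y _; exact: Eg0.
Qed.

End law_and_integral.

(** Open rays form a generating class that is stable under intersection. *)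
Lemma eq_law_gt d1 d2 (T1 : measurableType d1) (T2 : measurableType d2)
  (R : realType) (P1 : probability T1 R) (P2 : probability T2 R)
  (Z1 : T1 -> R) (Z2 : T2 -> R) :
  measurable_fun setT Z1 -> measurable_fun setT Z2 ->
  (forall x, P1 [set w | x < Z1 w] = P2 [set w | x < Z2 w]) ->
  eq_law P1 Z1 P2 Z2.
Proof.
move=> mZ1 mZ2 H A mA.
pose Y1 : {RV P1 >-> R} := HB.pack Z1 (isMeasurableFun.Build _ _ _ _ Z1 mZ1).
pose Y2 : {RV P2 >-> R} := HB.pack Z2 (isMeasurableFun.Build _ _ _ _ Z2 mZ2).
apply: (@measure_unique _ _ _ (@RGenOInfty.G R)
   (fun k => `](- k%:R), +oo[%classic) _ _ _ _
   (distribution P1 Y1) (distribution P2 Y2)) => //.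
- exact: RGenOInfty.measurableE.
- move=> _ _ [x ->] [y ->]; exists (Num.max x y).
  by apply/seteqP; split=> z /=; rewrite !in_itv /= !andbT gt_max => /andP.
- by move=> k; exists (- k%:R).
- apply/seteqP; split=> // z _; exists (Num.bound `|z|) => //=.
  rewrite in_itv /= andbT.
  by have := archi_boundP (normr_ge0 z); rewrite ltr_norml => /andP[].
- move=> _ [x ->]; have := H x; rewrite /distribution /pushforward.
  by congr (P1 _ = P2 _); apply/seteqP; split=> z /=; rewrite in_itv /= andbT.
- by move=> k; rewrite (le_lt_trans (probability_le1 _ _)) ?ltry.
Qed.

Section convergence_in_law.
Context d (T : measurableType d) (R : realType) (P : probability T R).

Lemma integral_le1_fin_num (f : T -> R) : measurable_fun setT f ->
  (forall w, 0 <= f w <= 1) -> (\int[P]_w (f w)%:E)%E \is a fin_num.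
Proof.
move=> mf f01; have f0 w : 0 <= f w by case/andP: (f01 w).
rewrite ge0_fin_numE; last by apply: integral_ge0 => w _; rewrite lee_fin.
apply: (@le_lt_trans _ _ (\int[P]_w 1%:E)%E).
  apply: ge0_le_integral => //.
  - by move=> w _; rewrite lee_fin.
  - exact/measurable_EFinP.
  - by move=> w _; rewrite lee_fin; case/andP: (f01 w).
by rewrite integral_cst//= probability_setT mule1 ltry.
Qed.

(** Convergence in probability implies convergence of the integrals of bounded
    Lipschitz functions: where the two variables are within [e] the Lipschitz
    bound applies, and elsewhere [h] varies by at most [1]. *)
Lemma integral_lipschitz_le (Y Y' : T -> R) (h : R -> R) (K e : R) :
  measurable_fun setT Y -> measurable_fun setT Y' -> measurable_fun setT h ->
  (forall y, 0 <= h y <= 1) -> 0 <= K -> 0 <= e ->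
  (forall y y', `|h y - h y'| <= K * `|y - y'|) ->
  (\int[P]_w (h (Y w))%:E <=
   \int[P]_w (h (Y' w))%:E +
     ((K * e)%:E + P [set w | (e < `|Y w - Y' w|)%R]))%E.
Proof.
move=> mY mY' mh h01 K0 e0 hK; set B := [set w | _].
have mB : measurable B.
  apply: (measurable_gt_set (Z := fun w => `|Y w - Y' w|)).
  by apply: measurableT_comp => //; exact: measurable_funB.
have h0 y : 0 <= h y by case/andP: (h01 y).
have I0 w : 0 <= \1_B w :> R by rewrite indicE.
have -> : ((K * e)%:E + P B)%E =
   (\int[P]_w (K * e)%:E + \int[P]_w (\1_B w)%:E)%E.
  by rewrite integral_cst//= probability_setT mule1 integral_indic// setIT.
have mhY' : measurable_fun setT (fun w => (h (Y' w))%:E).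
  exact/measurable_EFinP/measurableT_comp.
have mI : measurable_fun setT (fun w => (\1_B w : R)%:E).
  exact/measurable_EFinP/measurable_indic.
have Ke0 : 0 <= K * e by rewrite mulr_ge0.
rewrite -ge0_integralD//.
rewrite -ge0_integralD//; last 3 first.
- by move=> w _; rewrite lee_fin.
- by move=> w _; rewrite adde_ge0 ?lee_fin.
- exact: emeasurable_funD.
apply: ge0_le_integral => //.
- by move=> w _; rewrite lee_fin.
- exact/measurable_EFinP/measurableT_comp.
- by apply: emeasurable_funD => //; exact: emeasurable_funD.
move=> w _; rewrite -!EFinD lee_fin indicE.
have [wB|wB] := boolP (w \in B).
  have /andP[_ h1] := h01 (Y w); have := h0 (Y' w).
  by have : (true%:R : R) = 1 by []; lra.
have : ~ (e < `|Y w - Y' w|) by move=> /= ?; move/negP: wB; apply; rewrite inE.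
move=> /negP; rewrite -leNgt => Ye.
have := hK (Y w) (Y' w); have := ler_norm (h (Y w) - h (Y' w)).
have : K * `|Y w - Y' w| <= K * e by rewrite ler_wpM2l.
by have : (false%:R : R) = 0 by []; lra.
Qed.

End convergence_in_law.

(** * The moment generating function on an interval determines the law *)

Section same_expectation.
Context d1 d2 (T1 : measurableType d1) (T2 : measurableType d2) (R : realType).
Context (P1 : probability T1 R) (P2 : probability T2 R).
Context (Z1 : T1 -> R) (Z2 : T2 -> R).
Implicit Types f g : R -> R.

(** Working with two variables on their own probability spaces avoids signed
    measures: this is the vanishing of the difference of the laws of [Z1] and
    [Z2] against [f].  It is a vector space of functions, closed under dominated
    limits. *)
Definition same_expectation f : Prop :=
  [/\ P1.-integrable setT (EFin \o (f \o Z1)),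
      P2.-integrable setT (EFin \o (f \o Z2)) &
      (\int[P1]_w (f (Z1 w))%:E = \int[P2]_w (f (Z2 w))%:E)%E].

Lemma same_expectation1 : same_expectation (cst 1).
Proof.
have I1 d (T : measurableType d) (P : probability T R) :
    (\int[P]_w (1 : R)%:E = 1)%E.
  by rewrite integral_cst//= probability_setT mule1.
split; [exact: finite_measure_integrable_cst..|].
by transitivity (1%E : \bar R); [exact: I1|apply/esym; exact: I1].
Qed.

Lemma eq_same_expectation f g : f =1 g ->
  same_expectation f -> same_expectation g.
Proof. by move=> /funext ->. Qed.

Lemma same_expectationZ (a : R) f : same_expectation f ->
  same_expectation (fun z => a * f z).
Proof.
move=> [i1 i2 e]; split.
- exact: (integrableZl measurableT a i1).
- exact: (integrableZl measurableT a i2).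
- under eq_integral do rewrite EFinM.
  rewrite (integralZl measurableT i1) e -(integralZl measurableT i2).
  by apply: eq_integral => w _; rewrite EFinM.
Qed.

Lemma same_expectationD f g : same_expectation f -> same_expectation g ->
  same_expectation (fun z => f z + g z).
Proof.
move=> [i1 i2 e] [j1 j2 e']; split.
- exact: (integrableD measurableT i1 j1).
- exact: (integrableD measurableT i2 j2).
- have := integralD_EFin measurableT i1 j1.
  have := integralD_EFin measurableT i2 j2.
  by rewrite /= e e' => <- ->.
Qed.

Lemma same_expectationB f g : same_expectation f -> same_expectation g ->
  same_expectation (fun z => f z - g z).
Proof.
move=> Ef Eg; have := same_expectationD Ef (same_expectationZ (-1) Eg).
by apply: eq_same_expectation => z; rewrite mulN1r.
Qed.

Lemma same_expectation_sum (N : nat) (f : nat -> R -> R) :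
  (0 < N)%N -> (forall k, same_expectation (f k)) ->
  same_expectation (fun z => \sum_(0 <= k < N) f k z).
Proof.
move=> + Ef; elim: N => [//|[_ _|N IH _]].
  by apply: eq_same_expectation (Ef 0%N) => z; rewrite big_nat1.
by apply: eq_same_expectation (same_expectationD (IH _) (Ef N.+1)) => // z;
  rewrite [RHS]big_nat_recr.
Qed.

Lemma same_expectation_lim (fn : nat -> R -> R) f (W : R -> R) :
  (forall k, same_expectation (fn k)) -> same_expectation W ->
  (forall k z, `|fn k z| <= W z) ->
  (forall z, fn k z @[k --> \oo] --> f z) -> same_expectation f.
Proof.
move=> Ef [iW1 iW2 _] fW ff.
have H d (T : measurableType d) (P : probability T R) (Z : T -> R) :
    (forall k, P.-integrable setT (EFin \o (fn k \o Z))) ->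
    P.-integrable setT (EFin \o (W \o Z)) ->
    P.-integrable setT (EFin \o (f \o Z)) /\
    (\int[P]_w (fn k (Z w))%:E @[k --> \oo] --> \int[P]_w (f (Z w))%:E)%E.
  move=> ifn iW.
  have mf : measurable_fun setT (EFin \o (f \o Z)).
    apply/measurable_EFinP.
    apply: (measurable_fun_cvg (h := fun k => fn k \o Z)).
      by move=> k; have /integrableP[/measurable_EFinP] := ifn k.
    by move=> w _; exact: ff.
  have [] := @dominated_convergence _ _ _ P setT measurableT
    (fun k => EFin \o (fn k \o Z)) (EFin \o (f \o Z)) (EFin \o (W \o Z)).
  - by move=> k; have /integrableP[] := ifn k.
  - exact: mf.
  - apply: aeW => w _ /=; apply: cvg_EFin; first exact: nearW.
    exact: ff.
  - exact: iW.
  - by apply: aeW => w k _; rewrite /= lee_fin; exact: fW.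
  - by [].
have [|i1 c1] := H _ _ P1 Z1 _ iW1; first by move=> k; have [] := Ef k.
have [|i2 c2] := H _ _ P2 Z2 _ iW2; first by move=> k; have [] := Ef k.
split=> //; apply: (cvg_unique _ c1) => //.
have -> : (fun k => \int[P1]_w (fn k (Z1 w))%:E)%E =
          (fun k => \int[P2]_w (fn k (Z2 w))%:E)%E.
  by apply/funext => k; have [] := Ef k.
exact: c2.
Qed.

End same_expectation.

(** Below, [2 a] is the length of the interval on which the moment generating
    functions agree.  The weight [expR (a * z)] moves the origin to the middle
    of that interval, so that the weighted laws have exponential moments of both
    signs. *)
Section mgf_weights.
Context d1 d2 (T1 : measurableType d1) (T2 : measurableType d2) (R : realType).
Context (P1 : probability T1 R) (P2 : probability T2 R).
Context (Z1 : T1 -> R) (Z2 : T2 -> R).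
Context (a : R) (a0 : 0 < a).
Local Notation Ex := (same_expectation P1 P2 Z1 Z2).
Context (same_mgf : forall q : R, 0 < q < a + a -> Ex (fun z => expR (q * z))).

(** Differentiation of the moment generating function [n] times, carried out by
    dominated convergence of the difference quotients. *)
Lemma same_expectation_monomial_expR n q : 0 < q < a + a ->
  Ex (fun z => z ^+ n * expR (q * z)).
Proof.
elim: n q => [|n IH] q qa.
  by apply: eq_same_expectation (same_mgf qa) => z; rewrite expr0 mul1r.
(* A third of the distance to the boundary: increments of the exponent are at
   most [r], and the factor [|z|^n.+1] costs another [r] in the rate. *)
pose r := Num.min q (a + a - q) / 3.
have [r0 rq raq] : [/\ 0 < r, r * 2 < q & q + r * 2 < a + a].
  rewrite /r; case/andP: qa => q0 q1; split.
  - by rewrite divr_gt0// lt_min q0 subr_gt0.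
  - have : Num.min q (a + a - q) <= q by rewrite ge_min lexx.
    by move: (Num.min _ _) => m; lra.
  - have : Num.min q (a + a - q) <= a + a - q by rewrite ge_min lexx orbT.
    by move: (Num.min _ _) => m; lra.
have [|C C0 hC] := @normX_expR_le R n.+1 r (r * 2); first by lra.
pose e k : R := r / k.+1%:R.
have e0 k : 0 < e k by rewrite divr_gt0.
have er k : e k <= r by rewrite ler_pdivrMr ?ltr0Sn// ler_peMr ?ler1n// ltW.
pose fn k z := (e k)^-1 *
  (z ^+ n * expR ((q + e k) * z) - z ^+ n * expR (q * z)).
have fnE k z :
    fn k z = z ^+ n * expR (q * z) * ((e k)^-1 * (expR (e k * z) - 1)).
  by rewrite /fn mulrDl expRD; ring.
apply: (@same_expectation_lim _ _ _ _ _ _ _ _ _ fn _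
  (fun z => C * (expR ((q + r * 2) * z) + expR ((q - r * 2) * z)))).
- move=> k; apply/same_expectationZ/same_expectationB; apply: IH => //.
  by have := e0 k; have := er k; lra.
- by apply/same_expectationZ/same_expectationD; apply: same_mgf; lra.
- move=> k z; rewrite fnE normrM normrM normrX (ger0_norm (expR_ge0 _)).
  have h1 := expR_diffquot_le z (e0 k).
  have h2 : `|z| * expR (e k * `|z|) <= `|z| * expR (r * `|z|).
    by rewrite ler_wpM2l// ler_expR ler_wpM2r.
  apply: (@le_trans _ _ (expR (q * z) * (`|z| ^+ n.+1 * expR (r * `|z|)))).
    rewrite [X in X * _]mulrC -mulrA ler_wpM2l ?expR_ge0// exprSr -mulrA.
    by rewrite ler_wpM2l ?exprn_ge0// (le_trans h1).
  apply: (le_trans (ler_wpM2l (expR_ge0 _) (hC z))).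
  by rewrite mulrCA mulrDr -!expRD !mulrDl !mulNr.
- move=> z; rewrite exprSr mulrAC; under eq_fun do rewrite fnE.
  by apply: cvgMr; exact: expR_diffquot_cvg.
Qed.

(** All moments of [g] against the weighted difference of the two laws vanish.
    Asking for every power of [z] makes the property stable under
    multiplication by entire functions of small exponential type. *)
Definition weighted_same (g : R -> R) : Prop :=
  (forall z, `|g z| <= 1) /\
  forall n, Ex (fun z => z ^+ n * expR (a * z) * g z).

Lemma weighted_same1 : weighted_same (cst 1).
Proof.
split=> [z|n]; first by rewrite normr1.
apply: eq_same_expectation (@same_expectation_monomial_expR n a _) => [z|].
  by rewrite mulr1.
by have := a0; lra.
Qed.

(** The partial sums of [F] are dominated by [expR (b * |z|)], which is
    integrable against the weight since [b < a].  The product [F * g] may be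
    unbounded, hence the conclusion is about integrals and not about
    [weighted_same]. *)
Lemma weighted_same_power_series (c : nat -> R) (F : R -> R) (b : R) g :
  0 <= b < a -> (forall k, `|c k| <= b ^+ k / k`!%:R) ->
  (forall z, series (fun k => c k * z ^+ k) @ \oo --> F z) ->
  weighted_same g ->
  forall n, Ex (fun z => z ^+ n * expR (a * z) * (F z * g z)).
Proof.
move=> /andP[b0 ba] cb cF [g1 Eg] n.
(* A rate strictly between [b] and [a]: one gap absorbs the power of [z], the
   other keeps the dominating exponentials inside the interval. *)
pose b' := (a + b) / 2.
have [|C C0 hC] := @normX_expR_le R n b b'; first by rewrite /b'; lra.
pose fn k z := \sum_(0 <= i < k.+1) c i * (z ^+ (n + i) * expR (a * z) * g z).
have fnE k z : fn k z =
    z ^+ n * expR (a * z) * g z * \sum_(0 <= i < k.+1) c i * z ^+ i.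
  by rewrite mulr_sumr; apply: eq_bigr => i _; rewrite exprD; ring.
apply: (@same_expectation_lim _ _ _ _ _ _ _ _ _ fn _ (fun z =>
   C * (expR ((a + b') * z) + expR ((a - b') * z)))).
- move=> k; apply: same_expectation_sum => // i.
  exact: same_expectationZ.
- apply/same_expectationZ/same_expectationD; apply: same_mgf; rewrite /b'; lra.
- move=> k z; rewrite fnE !normrM normrX (ger0_norm (expR_ge0 _)).
  apply: (@le_trans _ _ (expR (a * z) * (`|z| ^+ n * expR (b * `|z|)))).
    rewrite -!mulrA mulrCA ler_wpM2l ?expR_ge0// ler_wpM2l ?exprn_ge0//.
    rewrite -[leRHS]mul1r ler_pM//; exact: norm_power_series_le.
  apply: (le_trans (ler_wpM2l (expR_ge0 _) (hC z))).
  by rewrite mulrCA mulrDr -!expRD !mulrDl !mulNr.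
- move=> z; under eq_fun do rewrite fnE.
  rewrite [F z * _]mulrC mulrA; apply: cvgMr.
  have := cF z; rewrite -(cvg_shiftS (series _)); exact.
Qed.

(** Multipliers are closed under products and bounded pointwise limits, and
    contain the functions [sin (b * z)] for small [b]; this produces
    discontinuous ones such as the sign. *)
Definition multiplier (h : R -> R) : Prop :=
  (forall z, `|h z| <= 1) /\
  forall g, weighted_same g -> weighted_same (fun z => h z * g z).

Lemma multiplier_sin (b : R) : 0 <= b < a -> multiplier (fun z => sin (b * z)).
Proof.
move=> ba; have b0 : 0 <= b by case/andP: ba.
have s1 z : `|sin (b * z)| <= 1 by rewrite ler_norml sin_geN1 sin_le1.
split=> // g Qg; split=> [z|].
  by rewrite normrM -[leRHS]mul1r ler_pM//; case: Qg.
pose c k : R := (odd k)%:R * (-1) ^+ k.-1./2 * b ^+ k / k`!%:R.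
apply: (@weighted_same_power_series c (fun z => sin (b * z)) b) => //.
- move=> k; rewrite /c !normrM normrX normrN1 expr1n mulr1.
  rewrite normrX normr_nat normfV normr_nat (ger0_norm b0).
  by rewrite ler_wpM2r ?invr_ge0// ler_piMl ?exprn_ge0// lern1 leq_b1.
- move=> z; rewrite sin.unlock.
  have -> : (fun k => c k * z ^+ k) = sin_coeff (b * z).
    by apply/funext => k; rewrite /c /sin_coeff /= exprMn; ring.
  exact: is_cvg_series_sin_coeff.
Qed.

Lemma multiplier_lim (hn : nat -> R -> R) (h : R -> R) :
  (forall k, multiplier (hn k)) ->
  (forall z, hn k z @[k --> \oo] --> h z) -> multiplier h.
Proof.
move=> Mh hh.
have h1 z : `|h z| <= 1.
  have hz : `|hn k z| @[k --> \oo] --> `|h z| by apply: cvg_norm; exact: hh.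
  rewrite -(cvg_lim _ hz)//; apply: limr_le.
    by apply/cvg_ex; exists `|h z|.
  by apply: nearW => k; have [] := Mh k.
split=> // g Qg; have [g1 Eg] := Qg; split=> [z|n].
  by rewrite normrM -[leRHS]mul1r ler_pM.
have [C C0 hC] := normX_expR_le n (divr_gt0 a0 (ltr0Sn R 1)).
pose b := a / 2.
apply: (@same_expectation_lim _ _ _ _ _ _ _ _ _
  (fun k z => z ^+ n * expR (a * z) * (hn k z * g z)) _ (fun z =>
   C * (expR ((a + b) * z) + expR ((a - b) * z)))).
- by move=> k; have [_ /(_ _ Qg)[_]] := Mh k; exact.
- apply/same_expectationZ/same_expectationD; apply: same_mgf;
    by rewrite /b; have := a0; lra.
- move=> k z; rewrite !normrM normrX (ger0_norm (expR_ge0 _)).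
  apply: (@le_trans _ _ (expR (a * z) * (`|z| ^+ n * expR (0 * `|z|)))).
    rewrite -!mulrA mulrCA mul0r expR0 mulr1 ler_wpM2l ?expR_ge0//.
    rewrite ler_piMr ?exprn_ge0// -[leRHS]mul1r ler_pM//.
    by have [] := Mh k.
  apply: (le_trans (ler_wpM2l (expR_ge0 _) (hC z))).
  by rewrite mulrCA mulrDr -!expRD !mulrDl !mulNr.
- by move=> z; apply: cvgMr; apply: cvgMl; exact: hh.
Qed.

Lemma multiplier_sqr h : multiplier h -> multiplier (fun z => h z ^+ 2).
Proof.
move=> [h1 Mh]; split=> [z|g Qg]; first by rewrite normrX exprn_ile1.
by under eq_fun do rewrite -mulrA; apply/Mh/Mh.
Qed.

Lemma multiplier_sharpen h : multiplier h ->
  multiplier (fun z => sharpen (h z)).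
Proof.
move=> [h1 Mh].
have k1 z : `|sharpen (h z)| <= 1.
  have := h1 z; rewrite /sharpen !ler_norml; move: (h z) => x /andP[l u].
  have p1 : 0 <= (1 - x) ^+ 2 * (2 + x) by rewrite mulr_ge0 ?sqr_ge0//; lra.
  have p2 : 0 <= (1 + x) ^+ 2 * (2 - x) by rewrite mulr_ge0 ?sqr_ge0//; lra.
  by apply/andP; split; lra.
split=> // g Qg; have [g1 Eg] := Qg; split=> [z|n].
  by rewrite normrM -[leRHS]mul1r ler_pM.
have [_ E1] := Mh _ Qg; have [_ E3] := Mh _ (Mh _ (Mh _ Qg)).
apply: eq_same_expectation (same_expectationD
  (same_expectationZ (3 / 2) (E1 n)) (same_expectationZ (- 2^-1) (E3 n))) => z.
by rewrite /sharpen; field.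
Qed.

End mgf_weights.

Section mgf_uniqueness.
Context d1 d2 (T1 : measurableType d1) (T2 : measurableType d2) (R : realType).
Context (P1 : probability T1 R) (P2 : probability T2 R).
Context (Z1 : T1 -> R) (Z2 : T2 -> R).
Context (a : R) (a0 : 0 < a).
Local Notation Ex := (same_expectation P1 P2 Z1 Z2).
Local Notation multiplier := (multiplier P1 P2 Z1 Z2 a).
Local Notation weighted_same := (weighted_same P1 P2 Z1 Z2 a).
Context (same_mgf : forall q : R, 0 < q < a + a -> Ex (fun z => expR (q * z))).

Lemma multiplier_sg h : multiplier h -> multiplier (fun z => Num.sg (h z)).
Proof.
move=> Mh; have [h1 _] := Mh.
apply: (@multiplier_lim _ _ _ _ _ _ _ _ _ _ a0 same_mgf
  (fun k z => iter k (@sharpen R) (h z))).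
  by elim=> [//|k IH]; exact: multiplier_sharpen IH.
by move=> z; exact: cvg_iter_sharpen.
Qed.

(** For fixed [z] and small [b > 0], [sin (b * z)] has the sign of [z]. *)
Lemma multiplier_sg_id : multiplier Num.sg.
Proof.
apply: (@multiplier_lim _ _ _ _ _ _ _ _ _ _ a0 same_mgf
  (fun k z => Num.sg (sin (a / k.+2%:R * z)))).
  move=> k; apply/multiplier_sg/multiplier_sin => //.
  by rewrite divr_ge0 ?ltW//= ltr_pdivrMr// ltr_pMr// ltr1n.
move=> z; apply: cvg_near_cst; near=> k.
have k0 : (0 : R) < k.+2%:R by [].
have -> : a / k.+2%:R * z = Num.sg z * (a / k.+2%:R * `|z|).
  by rewrite mulrCA mulr_sg_norm.
rewrite sin_sg sgrM sgr_id.
have [->|z0] := eqVneq z 0; first by rewrite sgr0 mul0r.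
rewrite (gtr0_sg (x := sin _)) ?mulr1// sin2_gt0//; apply/andP; split.
  by rewrite mulr_gt0 ?divr_gt0// normr_gt0.
rewrite mulrAC ltr_pdivrMr//.
apply: (@lt_le_trans _ _ k%:R); first by near: k; exact: nbhs_infty_gtr.
rewrite -natrM ler_nat mul2n -addnn.
exact: (leq_trans (leqnSn _) (leq_trans (leqnSn _) (leq_addr _ _))).
Unshelve. all: by end_near. Qed.

(** The weight is removed by multiplying with [expR (- b * z)], an entire
    function of type [b < a], and letting [b] tend to [a].  Reaching [b = a]
    directly is impossible, the exponent [0] being an endpoint of the
    interval. *)
Lemma same_expectation_untilt g : weighted_same g -> Ex g.
Proof.
move=> Qg; have [g1 _] := Qg.
have e0 k : 0 < a / k.+2%:R by rewrite divr_gt0.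
have ea k : a / k.+2%:R < a by rewrite ltr_pdivrMr// ltr_pMr// ltr1n.
have E1 : Ex (cst 1) by exact: same_expectation1.
apply: (@same_expectation_lim _ _ _ _ _ _ _ _ _
  (fun k z => expR (a / k.+2%:R * z) * g z) _ (fun z => 1 + expR (a * z))).
- move=> k; pose b := a - a / k.+2%:R.
  have b0 : 0 <= b < a by rewrite /b subr_ge0 (ltW (ea k)) gtrBl e0.
  have := @weighted_same_power_series _ _ _ _ _ _ _ _ _ _ same_mgf
    (fun i => (- b) ^+ i / i`!%:R) (fun z => expR (- b * z)) b g b0.
  move=> /(_ _ _ Qg 0%N) H; apply: eq_same_expectation (H _ _).
  + by move=> z; rewrite expr0 mul1r mulrA -expRD -mulrDl /b opprB subrKC.
  + move=> i; rewrite normrM normrX normrN normfV normr_nat ger0_norm//.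
    by case/andP: b0.
  + move=> z; have -> : (fun i => (- b) ^+ i / i`!%:R * z ^+ i) =
      exp_coeff (- b * z).
      by apply/funext => i; rewrite /exp_coeff /= exprMn; ring.
    exact: is_cvg_series_exp_coeff.
- by apply: same_expectationD => //; apply: same_mgf; have := a0; lra.
- move=> k z; rewrite normrM ger0_norm ?expR_ge0//.
  rewrite -[leRHS]mulr1; apply: ler_pM => //; rewrite ?expR_ge0//.
  have [z0|z0] := leP 0 z.
    by rewrite ler_wpDl// ler_expR ler_wpM2r// ltW.
  rewrite ler_wpDr ?expR_ge0// -[leRHS]expR0 ler_expR.
  by rewrite pmulr_rle0 ?ltW// e0.
- move=> z; rewrite -[X in _ --> X]mul1r; apply: cvgMl.
  rewrite -[X in _ --> X]expR0; apply: continuous_cvg.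
    exact: continuous_expR.
  rewrite -[X in _ --> X](mul0r z); apply: cvgMl.
  rewrite -[X in _ --> X](mulr0 a); apply: cvgMr.
  by have := @cvg_harmonic R; rewrite -cvg_shiftS; exact.
Qed.

(** The indicator of positive numbers is half the sum of the sign and its
    square. *)
Lemma same_probability_gt0 :
  measurable_fun setT Z1 -> measurable_fun setT Z2 ->
  P1 [set w | 0 < Z1 w] = P2 [set w | 0 < Z2 w].
Proof.
move=> mZ1 mZ2.
have Q1 := weighted_same1 a0 same_mgf.
have Ms := multiplier_sg_id; have Ms2 := multiplier_sqr Ms.
have E1 := same_expectation_untilt (Ms.2 _ Q1).
have E2 := same_expectation_untilt (Ms2.2 _ Q1).
have [_ _] := same_expectationZ 2^-1 (same_expectationD E1 E2).
have H d (T : measurableType d) (P : probability T R) (Z : T -> R) :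
    measurable_fun setT Z ->
    (\int[P]_w (2^-1 * (Num.sg (Z w) * 1 + Num.sg (Z w) ^+ 2 * 1))%:E)%E =
    P [set w | 0 < Z w].
  move=> mZ; have mA := measurable_gt_set 0 mZ.
  have := integral_indic P measurableT mA; rewrite setIT => <-.
  apply: eq_integral => w _; congr (_%:E); rewrite indicE !mulr1.
  have [z0|z0|z0] := ltgtP (Z w) 0.
  - by rewrite ltr0_sg// memNset ?sqrrN ?expr1n ?addNr ?mulr0//= ltNge ltW.
  - by rewrite gtr0_sg// mem_set//= expr1n; field.
  - by rewrite z0 sgr0 memNset ?expr0n/= ?addr0 ?mulr0// z0 ltxx.
by rewrite !H.
Qed.

End mgf_uniqueness.

(** Replacing [Z] by [Z - x] multiplies the moment generating function at [q] by
    [expR (- q * x)], so that equality of the probabilities of being positive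
    for all shifts gives the equality of all tails. *)
Lemma eq_law_mgf d1 d2 (T1 : measurableType d1) (T2 : measurableType d2)
  (R : realType) (P1 : probability T1 R) (P2 : probability T2 R)
  (Z1 : T1 -> R) (Z2 : T2 -> R) (q0 : R) :
  0 < q0 -> measurable_fun setT Z1 -> measurable_fun setT Z2 ->
  (forall q, 0 < q < q0 ->
    (\int[P1]_w (expR (q * Z1 w))%:E < +oo /\
     \int[P1]_w (expR (q * Z1 w))%:E = \int[P2]_w (expR (q * Z2 w))%:E)%E) ->
  eq_law P1 Z1 P2 Z2.
Proof.
move=> q00 mZ1 mZ2 H; apply: eq_law_gt => // x.
have mgf_int d (T : measurableType d) (P : probability T R) (Z : T -> R) q :
  measurable_fun setT Z -> (\int[P]_w (expR (q * Z w))%:E < +oo)%E ->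
  P.-integrable setT (EFin \o (fun w => expR (q * Z w))).
  move=> mZ fZ; apply/integrableP; split.
    apply/measurable_EFinP; apply: measurableT_comp => //.
    exact: measurable_funM.
  apply: le_lt_trans fZ; rewrite le_eqVlt; apply/orP; left; apply/eqP.
  by apply: eq_integral => w _; rewrite /= ger0_norm ?expR_ge0.
have := @same_probability_gt0 _ _ _ _ _ P1 P2 (fun w => Z1 w - x)
  (fun w => Z2 w - x) (q0 / 2) (divr_gt0 q00 (ltr0Sn R 1)).
rewrite -splitr => /(_ _ _ _) K.
have -> : [set w | x < Z1 w] = [set w | 0 < Z1 w - x].
  by apply/seteqP; split=> w /=; rewrite subr_gt0.
have -> : [set w | x < Z2 w] = [set w | 0 < Z2 w - x].
  by apply/seteqP; split=> w /=; rewrite subr_gt0.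
apply: K; [|exact: measurable_funB..].
move=> q /H[fZ eZ].
have i1 := mgf_int _ _ _ _ _ mZ1 fZ.
have i2 : P2.-integrable setT (EFin \o (fun w => expR (q * Z2 w))).
  by apply: mgf_int => //; rewrite -eZ.
have := same_expectationZ (expR (- (q * x))) (And3 i1 i2 eZ :
  same_expectation P1 P2 Z1 Z2 (fun z => expR (q * z))).
have e z : expR (- (q * x)) * expR (q * z) = expR (q * (z - x)).
  by rewrite -expRD mulrBr addrC.
move=> [j1 j2 ej]; split.
- by apply: eq_integrable j1 => // w _; rewrite /= e.
- by apply: eq_integrable j2 => // w _; rewrite /= e.
- under eq_integral do rewrite -e.
  by rewrite ej; under [RHS]eq_integral do rewrite -e.
Qed.

(** * Moment generating functions and continuity of Levy processes *)

Section levy_exponential_moment.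
Context d (T : measurableType d) (R : realType) (P : probability T R).
Context (L : R -> {RV P >-> R}) (hL : levy_process L).

(** Stationarity compares with [L u - L 0], where [L 0] vanishes almost
    surely. *)
Lemma levy_increment_integral (f : R -> R) (s u : R) :
  measurable_fun setT f -> (forall y, 0 <= f y) -> 0 <= s -> 0 <= u ->
  (\int[P]_w (f (L (s + u) w - L s w))%:E = \int[P]_w (f (L u w))%:E)%E.
Proof.
move=> mf f0 s0 u0; have [L0 st _ _] := hL.
rewrite (eq_law_integral _ _ mf f0 (st s u s0 u0)).
- apply: ae_integral_eq => //.
  + by apply: measurableT_comp => //; exact: measurable_funB.
  + exact: measurableT_comp.
  + have : {ae P, forall w, L 0 w = 0}.
      apply: probability1_ae => //.
      rewrite -[X in measurable X]setTI.
      exact: (measurable_funP (L 0) measurableT [set 0] (measurable_set1 0)).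
    by apply: filterS => w; rewrite /= => ->; rewrite subr0.
- exact: measurable_funB.
- exact: measurable_funB.
Qed.

(** [L (s + u)] is almost surely the sum of the increments over [[0, s]] and
    [[s, s + u]], which are independent. *)
Lemma levy_mgfD (q s u : R) : 0 < s -> 0 < u ->
  (\int[P]_w (expR (q * L (s + u) w))%:E =
   \int[P]_w (expR (q * L s w))%:E * \int[P]_w (expR (q * L u w))%:E)%E.
Proof.
move=> s0 u0; have [L0 _ ind _] := hL.
pose f (y : R) := expR (q * y).
have mf : measurable_fun setT f.
  by apply: measurableT_comp => //; exact: measurable_funM.
have f0 y : 0 <= f y by rewrite expR_ge0.
pose U w := L s w - L 0 w; pose V w := L (s + u) w - L s w.
have mU : measurable_fun setT U by exact: measurable_funB.
have mV : measurable_fun setT V by exact: measurable_funB.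
have := levy_increment_integral mf f0 (ltW s0) (ltW u0).
have := levy_increment_integral mf f0 (lexx 0) (ltW s0).
rewrite add0r => <- <-; rewrite -/(U _) -/(V _).
have <- := @integral_indepM _ _ _ P U V f f mU mV mf mf f0 f0 _.
- have := levy_increment_integral mf f0 (lexx 0) (ltW (addr_gt0 s0 u0)).
  rewrite add0r => <-; apply: eq_integral => w _; congr (_%:E).
  by rewrite /f -expRD /U /V; congr expR; ring.
- move=> A B mA mB.
  (* The subdivision [0 < s < s + u]. *)
  pose t (i : nat) : R :=
    if i is i'.+1 then (if i' is 0%N then s else s + u) else 0.
  have := ind 2%N t (lexx _) _ (fun i => if i == ord0 then A else B) _.
  rewrite !big_ord_recl big_ord0 /= mule1 => <-.
  + congr (P _); apply/seteqP; split=> [w [Aw Bw] i _|w h].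
      by case: i => [[|[|//]]] ? /=.
    by split; [exact: (h ord0 I)|exact: (h (lift ord0 ord0) I)].
  + by case=> [|[|//]] _; rewrite /t// ltrDl.
  + by move=> i; case: ifP.
Qed.

Lemma levy_ramp_cvg (n x s : R) (u : nat -> R) :
  0 <= n -> 0 <= s -> (forall k, 0 <= u k) ->
  u k @[k --> \oo] --> s ->
  fine (\int[P]_w (ramp n x (L (u k) w))%:E)%E @[k --> \oo] -->
  fine (\int[P]_w (ramp n x (L s w))%:E)%E.
Proof.
move=> n0 s0 u0 us; have [_ _ _ sc] := hL.
pose h := ramp n x.
have h01 y : 0 <= h y <= 1 by rewrite ramp_ge0 ramp_le1.
have mh : measurable_fun setT h by exact: measurable_ramp.
have fin v : (\int[P]_w (h (L v w))%:E)%E \is a fin_num.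
  by apply: integral_le1_fin_num => // ; exact: measurableT_comp.
apply/cvgrPdist_le => eps eps0.
(* Chosen so that [n * e <= eps / 2], also when [n = 0]. *)
pose e := eps / 2 / (n + 1).
have e0 : 0 < e by rewrite !divr_gt0// ltr_wpDl.
have ne : n * e <= eps / 2.
  rewrite /e mulrA ler_pdivrMr ?ltr_wpDl// mulrC ler_wpM2l ?lerDl//.
  by rewrite divr_ge0// ltW.
have us' : u k @[k --> \oo] --> within `[0, +oo[%classic (nbhs s).
  move=> A hA.
  have uA : \forall k \near \oo, `[0, +oo[%classic (u k) -> A (u k) := us _ hA.
  change (\forall k \near \oo, A (u k)).
  by apply: filterS uA => k; apply; rewrite /= in_itv /= andbT.
have := cvg_comp _ _ us' (sc s s0 e e0) => /= pc.
have /fine_cvg pc' : (P [set w | (e < `|L (u k) w - L s w|)%R])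
    @[k --> \oo] --> (0 : R)%:E by exact: pc.
have eps2 : 0 < eps / 2 by rewrite divr_gt0.
move/cvgrPdist_le : pc' => /(_ _ eps2); apply: filterS => k /=.
rewrite sub0r normrN => pk.
set B := [set w | _] in pk.
have mB : measurable B.
  apply: (measurable_gt_set (Z := fun w => `|L (u k) w - L s w|)).
  by apply: measurableT_comp => //; exact: measurable_funB.
have PB : P B = (fine (P B))%:E by rewrite fineK// fin_num_measure.
have lip := fun y y' => @ramp_lipschitz R n x y y' n0.
have mL v := @measurable_funPT _ _ _ _ (L v).
have A1 := integral_lipschitz_le P (mL (u k)) (mL s) mh h01 n0 (ltW e0) lip.
have A2 := integral_lipschitz_le P (mL s) (mL (u k)) mh h01 n0 (ltW e0) lip.
have BE : [set w | e < `|L s w - L (u k) w|] = B.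
  by apply/seteqP; split => w /=; rewrite distrC.
rewrite -/B PB in A1; rewrite BE PB in A2.
rewrite -(fineK (fin s)) -(fineK (fin (u k))) in A1 A2.
rewrite -!EFinD !lee_fin in A1 A2.
have pk' := le_trans (ler_norm _) pk.
by rewrite ler_norml; apply/andP; split; lra.
Qed.

End levy_exponential_moment.

Section multiplicative_functions.
Context (R : realType).
Implicit Types F G : R -> \bar R.

Definition multiplicative_on_pos F : Prop :=
  (forall s, 0 <= F s)%E /\
  forall s u, 0 < s -> 0 < u -> F (s + u) = (F s * F u)%E.

Lemma multiplicative_natmul F (s : R) n : multiplicative_on_pos F -> 0 < s ->
  F (n.+1%:R * s) = (F s ^+ n.+1)%E.
Proof.
move=> [_ FD] s0; elim: n => [|n IH]; first by rewrite mul1r.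
by rewrite mulrSr mulrDl mul1r FD ?mulr_gt0// IH muleC -expeS.
Qed.

(** Values at [1 / n] are [n]-th roots of the value at [1], and nonnegative
    roots are unique.  An infinite value of [F] at [1 / n] would make [F 1]
    infinite, so the finiteness of [G] controls both functions. *)
Lemma multiplicative_eq_rational F G m n :
  multiplicative_on_pos F -> multiplicative_on_pos G ->
  F 1 = G 1 -> (forall s, 0 < s -> (G s < +oo)%E) ->
  F (m.+1%:R / n.+1%:R) = G (m.+1%:R / n.+1%:R).
Proof.
move=> Fm Gm FG1 Gfin; have [F0 _] := Fm; have [G0 _] := Gm.
have s0 : 0 < n.+1%:R^-1 :> R by rewrite invr_gt0.
suff e : F n.+1%:R^-1 = G n.+1%:R^-1.
  by rewrite (multiplicative_natmul m Fm s0) (multiplicative_natmul m Gm s0) e.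
have Fn := multiplicative_natmul n Fm s0.
have Gn := multiplicative_natmul n Gm s0.
rewrite mulfV// in Fn Gn; rewrite Fn Gn in FG1.
have Gf := Gfin _ s0; have Gf1 := Gfin 1 ltr01; rewrite Gn -FG1 in Gf1.
have powy : (+oo ^+ n.+1 = +oo :> \bar R)%E.
  elim: n {s0 Fn Gn FG1 Gf Gf1} => [|n IH]; first by rewrite expeS expe0 mule1.
  by rewrite expeS IH mulyy.
move: (F _) (G _) FG1 Gf Gf1 (F0 n.+1%:R^-1) (G0 n.+1%:R^-1).
move=> [x| |] [y| |] e yfin powfin x0 y0 //.
- rewrite -!EFin_expe in e; case: e => e; rewrite !lee_fin in x0 y0.
  by congr _%:E; apply/eqP; rewrite -(eqrXn2 (ltn0Sn n))// e.
- by rewrite powy ltxx in powfin.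
Qed.

End multiplicative_functions.

(** The numerator is the integer part plus one, so the approximations are
    positive even for [s = 0]: multiplicativity is used at positive times. *)
Lemma rational_approximation (R : realType) (s : R) : 0 <= s ->
  (Num.truncn (k.+1%:R * s)).+1%:R / k.+1%:R @[k --> \oo] --> s.
Proof.
move=> s0; have k0 k : (0 : R) < k.+1%:R by [].
apply: (@squeeze_cvgr _ _ _ _ (cst s) (fun k => s + k.+1%:R^-1)).
- near=> k; have := truncn_itv (mulr_ge0 (ltW (k0 k)) s0) => /andP[l u].
  rewrite ler_pdivlMr// ler_pdivrMr// mulrDl mulVf// [s * _]mulrC (ltW u) /=.
  by rewrite -[leLHS]natr1 lerD2r.
- exact: cvg_cst.
- rewrite -[X in _ --> X]addr0; apply: cvgD; first exact: cvg_cst.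
  exact: cvg_harmonic.
Unshelve. all: by end_near. Qed.

Section levy_identification.
Context d d' (T : measurableType d) (T' : measurableType d') (R : realType).
Context (P : probability T R) (P' : probability T' R).
Context (L : R -> {RV P' >-> R}) (N : R -> T -> R) (q0 : R).

(** A Levy process is identified in law, one time at a time, by a family [N]
    whose moment generating functions are multiplicative in time and which is
    continuous in law.  Agreement of the laws is obtained at positive rationals
    from [eq_law_mgf] and extended to real times by testing on ramps. *)
Lemma levy_eq_law_family :
  levy_process L -> (forall s, measurable_fun setT (N s)) -> 0 < q0 ->
  (forall q : R, 0 < q < q0 ->
    multiplicative_on_pos (fun s => \int[P]_w (expR (q * N s w))%:E)%E) ->
  (forall q s : R, 0 < q < q0 -> 0 < s ->
    (\int[P]_w (expR (q * N s w))%:E < +oo)%E) ->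
  (forall (n x s : R) (u : nat -> R),
    0 <= n -> 0 <= s -> (forall k, 0 <= u k) ->
    u k @[k --> \oo] --> s ->
    fine (\int[P]_w (ramp n x (N (u k) w))%:E)%E @[k --> \oo] -->
    fine (\int[P]_w (ramp n x (N s w))%:E)%E) ->
  eq_law P' (L 1) P (N 1) ->
  forall s : R, 0 <= s -> eq_law P' (L s) P (N s).
Proof.
move=> hL mN q00 Nm Nfin Ncvg LN1 s s0.
have mL v : measurable_fun setT (L v) by exact: measurable_funPT.
have rat m n : eq_law P' (L (m.+1%:R / n.+1%:R)) P (N (m.+1%:R / n.+1%:R)).
  apply: (eq_law_mgf q00) => // q qq.
  have e := @multiplicative_eq_rational R
    (fun s => \int[P']_w (expR (q * L s w))%:E)%E
    (fun s => \int[P]_w (expR (q * N s w))%:E)%E m n _ (Nm q qq) _ _.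
  rewrite e; first by split => //; apply: Nfin; rewrite // divr_gt0.
  - split=> [v|v u v0 u0]; last exact: levy_mgfD.
    by apply: integral_ge0 => w _; rewrite lee_fin expR_ge0.
  - have mexp : measurable_fun setT (fun y : R => expR (q * y)).
      by apply: measurableT_comp => //; exact: measurable_funM.
    have exp0 (y : R) : 0 <= expR (q * y) by rewrite expR_ge0.
    exact: (eq_law_integral (mL 1) (mN 1) mexp exp0 LN1).
  - by move=> v v0; exact: Nfin.
have fin_ramp d1 (T1 : measurableType d1) (P1 : probability T1 R) (Y : T1 -> R)
   n x : measurable_fun setT Y ->
   (\int[P1]_w (ramp n x (Y w))%:E)%E \is a fin_num.
  move=> mY; apply: integral_le1_fin_num => [|w].
    exact: measurableT_comp (measurable_ramp _ _) mY.
  by rewrite ramp_ge0 ramp_le1.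
have same_ramp (n : nat) x :
    (\int[P']_w (ramp n%:R x (L s w))%:E =
     \int[P]_w (ramp n%:R x (N s w))%:E)%E.
  rewrite -[LHS]fineK ?fin_ramp// -[RHS]fineK ?fin_ramp//; congr (_%:E).
  pose u k : R := (Num.truncn (k.+1%:R * s)).+1%:R / k.+1%:R.
  have u0 k : 0 <= u k by rewrite divr_ge0.
  have us : u k @[k --> \oo] --> s by exact: rational_approximation.
  have c1 := levy_ramp_cvg (x := x) hL (ler0n R n) s0 u0 us.
  have c2 := Ncvg n%:R x s u (ler0n R n) s0 u0 us.
  have e : (fun k => fine (\int[P']_w (ramp n%:R x (L (u k) w))%:E)%E) =
           (fun k => fine (\int[P]_w (ramp n%:R x (N (u k) w))%:E)%E).
    apply/funext => k; congr fine.
    apply: (eq_law_integral (mL _) (mN _) (measurable_ramp n%:R x)).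
      exact: ramp_ge0.
    exact: rat.
  by rewrite e in c1; exact: (cvg_unique _ c1 c2).
apply: eq_law_gt => // x.
have int_ramp d1 (T1 : measurableType d1) (P1 : probability T1 R) (Y : T1 -> R)
   n : measurable_fun setT Y ->
   P1.-integrable setT (EFin \o (ramp n x \o Y)).
  move=> mY; apply: (@le_integrable _ _ _ _ _ _ _ (EFin \o cst 1)) => //.
  - apply/measurable_EFinP.
    exact: measurableT_comp (measurable_ramp _ _) mY.
  - by move=> w _ /=; rewrite lee_fin normr1 ger0_norm ?ramp_ge0 ?ramp_le1.
  - exact: finite_measure_integrable_cst.
have [_ _] : same_expectation P' P (L s) (N s) (fun z => ((x < z)%R%:R : R)).
  apply: (@same_expectation_lim _ _ _ _ _ _ _ _ _
    (fun (k : nat) => ramp k%:R x) _ (cst 1)).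
  - by move=> k; split; [exact: int_ramp..|exact: same_ramp].
  - exact: same_expectation1.
  - by move=> k z; rewrite /= ger0_norm ?ramp_ge0 ?ramp_le1.
  - by move=> z; exact: ramp_cvg.
have H d1 (T1 : measurableType d1) (P1 : probability T1 R) (Y : T1 -> R) :
   measurable_fun setT Y ->
   (\int[P1]_w ((x < Y w)%R%:R : R)%:E)%E = P1 [set w | x < Y w].
  move=> mY; have mA := measurable_gt_set x mY.
  have := integral_indic P1 measurableT mA; rewrite setIT => <-.
  apply: eq_integral => w _; congr (_%:E); rewrite indicE.
  have [xY|Yx] := ltP x (Y w); first by rewrite mem_set.
  by rewrite memNset//= ltNge Yx.
by rewrite !H.
Qed.

End levy_identification.

(** * Moments of the scaling factors *)

Section absolute_moments.
Context d (T : measurableType d) (R : realType) (P : probability T R).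

Lemma measurable_norm_powR (q : R) :
  measurable_fun setT (fun y : R => `|y| `^ q).
Proof. by apply: (measurableT_comp (measurable_powR q)). Qed.

Lemma abs_moment_lty (Y : T -> R) (q r : R) : measurable_fun setT Y ->
  0 < q < r -> (\int[P]_w (`|Y w| `^ r)%:E < +oo)%E ->
  (\int[P]_w (`|Y w| `^ q)%:E < +oo)%E.
Proof.
move=> mY /andP[q0 qr] Yr.
have mYp p : measurable_fun setT (fun w => (`|Y w| `^ p)%:E).
  by apply/measurable_EFinP; exact: (measurableT_comp (measurable_norm_powR p)).
apply: (@le_lt_trans _ _ (\int[P]_w (1%:E + (`|Y w| `^ r)%:E))%E).
  apply: ge0_le_integral => //; first exact: emeasurable_funD.
  move=> w _; rewrite -EFinD lee_fin.
  have [Y1|Y1] := leP 1 `|Y w|.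
    by rewrite ler_wpDl// ler_powR// ltW.
  rewrite ler_wpDr ?powR_ge0//; have <- : 1 `^ q = 1 by rewrite powR1.
  by rewrite ge0_ler_powR ?nnegrE// ltW.
rewrite ge0_integralD//.
by rewrite integral_cst//= probability_setT mule1 lte_add_pinfty// ltry.
Qed.

Lemma abs_moment_gt0 (Y : T -> R) (q : R) : measurable_fun setT Y -> 0 < q ->
  (0 < P [set w | Y w != 0%R] -> 0 < \int[P]_w (`|Y w| `^ q)%:E)%E.
Proof.
move=> mY q0 Y0.
have mYq : measurable_fun setT (fun w => (`|Y w| `^ q)%:E).
  by apply/measurable_EFinP; exact: (measurableT_comp (measurable_norm_powR q)).
have I0 : (0 <= \int[P]_w (`|Y w| `^ q)%:E)%E.
  by apply: integral_ge0 => w _; rewrite lee_fin powR_ge0.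
rewrite lt0e I0 andbT; apply/eqP => Yq0.
have aI : (\int[P]_w `|(`|Y w| `^ q)%:E| = 0)%E.
  rewrite -Yq0; apply: eq_integral => w _.
  by rewrite gee0_abs// lee_fin powR_ge0.
have [N [mN N0 sN]] := (ae_eq_integral_abs P measurableT mYq).1 aI.
move: Y0; rewrite ltNge => /negP; apply; rewrite -N0.
apply: le_measure; rewrite ?inE//; last first.
  move=> w /= Yw; apply: sN => /= /(_ I) /eqP.
  by rewrite eqe powR_eq0 normr_eq0 (negPf Yw).
rewrite -[X in measurable X]setTI.
have -> : [set w | Y w != 0%R] = Y @^-1` (~` [set 0]).
  by apply/seteqP; split=> w /= /eqP.
by apply: mY => //; exact: measurableC.
Qed.

End absolute_moments.

Lemma qbar_moment d (T : measurableType d) (R : realType) (P : probability T R)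
    (I : set R) (X : R -> T -> R) :
  (0 < qbar P I X)%E ->
  exists2 q : R, 0 < q &
    forall t, I t -> (\int[P]_w (`|X t w| `^ q)%:E < +oo)%E.
Proof.
move=> /ereal_sup_gt[_ [q [_ Xq] <-]]; rewrite lte_fin => q0.
by exists q => // t /Xq; rewrite unlock.
Qed.

Lemma mule_pos_inj (R : realType) (c x y : \bar R) :
  (0 < c)%E -> (c < +oo)%E -> (x * c = y * c)%E -> x = y.
Proof.
move=> c0 coo; have cfin : c \is a fin_num by rewrite gt0_fin_numE.
move: cfin c0 => /fineK <-; rewrite lte_fin => c0.
move=> /(congr1 (fun z => z * (fine c)^-1%:E))%E.
by rewrite -!muleA -!EFinM divff ?gt_eqF// !mule1.
Qed.

Section scaling_factors.
Context (R : realType) (d : measure_display) (Om : measurableType d).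
Context (P : probability Om R) (T Lambda S : set R).
Context (X : R -> {RV P >-> R}) (M : R -> R -> {RV P >-> R}).
Context (hST : S `<=` T) (hX : multifractal T Lambda S X M).

(** The moment of order [q] of the scaling factor, written as the moment
    generating function of its logarithm. *)
Definition log_factor_mgf (q l t : R) : \bar R :=
  (\int[P]_w (expR (q * ln (M l t w)))%:E)%E.

Lemma measurable_expR_ln (q : R) :
  measurable_fun setT (fun y : R => expR (q * ln y)).
Proof.
by apply: measurableT_comp => //; exact: measurable_funM.
Qed.

Lemma factor_gt0_ae l t : Lambda l -> S t -> {ae P, forall w, 0 < M l t w}.
Proof.
move=> Ll St; have [M0 _ _ _] := hX Ll.
by apply: probability1_ae (M0 _ St); exact: measurable_gt_set.
Qed.

(** The one-dimensional case of the scaling relation, together with the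
    independence of [M l] and [X]. *)
Lemma scaling_abs_moment (q l t : R) : Lambda l -> S t ->
  (\int[P]_w (`|X (l * t) w| `^ q)%:E =
   log_factor_mgf q l t * \int[P]_w (`|X t w| `^ q)%:E)%E.
Proof.
move=> Ll St; have [_ _ ind fdd] := hX Ll.
have law : eq_law P (X (l * t)) P (fun w => M l t w * X t w).
  move=> A mA.
  have := fdd 1%N [tuple t] _ [set v | A (tnth v ord0)] _.
  rewrite /pushforward.
  have E (Y : R -> Om -> R) :
    (fun w => [tuple Y (tnth [tuple t] i) w | i < 1]) @^-1`
      [set v | A (tnth v ord0)] = Y t @^-1` A.
    by apply/seteqP; split => w /=; rewrite tnth_mktuple.
  rewrite (E (fun t => X (l * t))) (E (fun t w => M l t w * X t w)); apply.
  - by move=> i; rewrite (ord1 i).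
  - rewrite -[X in measurable X]setTI.
    exact: (measurable_tnth ord0 measurableT mA).
have mMX : measurable_fun setT (fun w => M l t w * X t w).
  exact: measurable_funM.
rewrite (eq_law_integral _ mMX (measurable_norm_powR q) _ law)//.
rewrite /log_factor_mgf.
rewrite -(@integral_indepM _ _ _ _ (M l t) (X t) _ (fun y => `|y| `^ q) _ _
  (measurable_expR_ln q) (measurable_norm_powR q))//.
- apply: ae_integral_eq.
  + exact: (measurableT_comp (measurable_norm_powR q) mMX).
  + apply: measurable_funM.
      exact: (measurableT_comp (measurable_expR_ln q)).
    exact: (measurableT_comp (measurable_norm_powR q)).
  + by move=> w; rewrite powR_ge0.
  + by move=> w; rewrite mulr_ge0 ?expR_ge0 ?powR_ge0.
  apply: filterS (factor_gt0_ae Ll St) => w M0.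
  rewrite normrM powRM// (gtr0_norm M0); congr (_ * _).
  by rewrite /powR gt_eqF.
- move=> A B mA mB; apply: ind.
  + by apply: sub_sigma_algebra; exists t => //; exists A.
  + by apply: sub_sigma_algebra; exists t; [exact: hST|exists B].
Qed.

Lemma log_factor_mgf_indep (q l t u : R) : Lambda l -> S t -> S u ->
  log_factor_mgf q l t = log_factor_mgf q l u.
Proof.
move=> Ll St Su; have [_ eqM _ _] := hX Ll.
exact: (eq_law_integral _ _ (measurable_expR_ln q) _ (eqM t u St Su)).
Qed.

Section moments.
Context (q t0 : R) (St0 : S t0).
Let c := (\int[P]_w (`|X t0 w| `^ q)%:E)%E.
Context (c0 : (0 < c)%E) (coo : (c < +oo)%E).

Lemma log_factor_mgf_lty (l t : R) : Lambda l -> S t ->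
  (\int[P]_w (`|X (l * t0) w| `^ q)%:E < +oo)%E ->
  (log_factor_mgf q l t < +oo)%E.
Proof.
move=> Ll St; rewrite (scaling_abs_moment _ Ll St0).
rewrite (log_factor_mgf_indep q Ll St St0).
by rewrite ltNge => h; rewrite ltNge leye_eq; apply: contra h => /eqP ->;
  rewrite gt0_mulye.
Qed.

(** Rescaling [X t0] by [l * m] in one step or in two steps gives the same
    moment, and [E|X t0|^q] is cancelled as a positive finite number. *)
Lemma log_factor_mgfM (l m t : R) : Lambda l -> Lambda m -> Lambda (l * m) ->
  S t -> S (m * t0) ->
  log_factor_mgf q (l * m) t = (log_factor_mgf q l t * log_factor_mgf q m t)%E.
Proof.
move=> Ll Lm Llm St Smt0.
have h1 := scaling_abs_moment q Llm St0.
have h2 := scaling_abs_moment q Ll Smt0; rewrite mulrA in h2.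
have h3 := scaling_abs_moment q Lm St0.
have i1 := log_factor_mgf_indep q Llm St St0.
have i2 := log_factor_mgf_indep q Ll St Smt0.
have i3 := log_factor_mgf_indep q Lm St St0.
move: h1 h2 h3 i1 i2 i3; rewrite -/c.
move: (log_factor_mgf q (l * m) t) (log_factor_mgf q l t)
  (log_factor_mgf q m t) => x y z h1 h2 h3 -> -> ->.
by apply: (mule_pos_inj c0 coo); rewrite -h1 h2 h3 muleA.
Qed.

End moments.

(** Continuity in law is tested on continuous functions of [M], but [ln] is not
    continuous at [0].  A ramp vanishes up to [x], so composing it with
    [ln (max y (expR x))] gives a continuous function of [y] that agrees with
    the ramp of [ln y] for every [y > 0]. *)
Lemma log_factor_ramp_cvg (l : R -> R) (t n x s : R) (u : nat -> R) :
  (exists2 t, S t & continuous_in_law P Lambda (fun l => M l t)) -> S t ->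
  0 <= n -> (forall s : R, 0 <= s -> Lambda (l s)) -> continuous l ->
  0 <= s -> (forall k, 0 <= u k) -> u k @[k --> \oo] --> s ->
  fine (\int[P]_w (ramp n x (ln (M (l (u k)) t w)))%:E)%E @[k --> \oo] -->
  fine (\int[P]_w (ramp n x (ln (M (l s) t w)))%:E)%E.
Proof.
move=> [t1 St1 cl] St n0 Ll lc s0 u0 us.
pose f (y : R) := ramp n x (ln (Num.max y (expR x))).
have f_cont : continuous f.
  move=> y.
  apply: (@continuous_comp _ _ _ (fun y : R => ln (Num.max y (expR x)))).
    apply: (@continuous_comp _ _ _ (fun y : R => Num.max y (expR x)) (@ln R)).
      by apply: continuous_max; [exact: cvg_id|exact: cvg_cst].
    by apply: continuous_ln; rewrite lt_max expR_gt0 orbT.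
  exact: ramp_continuous.
have f_bd : exists K : R, forall y, `|f y| <= K.
  by exists 1 => y; rewrite ger0_norm ?ramp_ge0 ?ramp_le1.
have mf : measurable_fun setT f by exact: continuous_measurable_fun.
have f0 y : 0 <= f y by exact: ramp_ge0.
have mE m : Lambda m ->
    ('E_P[f \o M m t1] = \int[P]_w (ramp n x (ln (M m t w)))%:E)%E.
  move=> Lm; have [_ eqM _ _] := hX Lm; rewrite unlock.
  rewrite (eq_law_integral _ _ mf f0 (eqM _ _ St1 St))//.
  apply: ae_integral_eq.
  - exact: (measurableT_comp mf).
  - apply: (measurableT_comp (measurable_ramp n x)).
    exact: (measurableT_comp (@measurable_ln R)).
  - by move=> w; exact: f0.
  - by move=> w; exact: ramp_ge0.
  apply: filterS (factor_gt0_ae Lm St) => w M0; rewrite /f.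
  have [//|Mx] := leP (expR x) (M m t w).
  rewrite expRK ramp_eq0// ramp_eq0// -(expRK x).
  by rewrite ler_ln ?posrE ?expR_gt0// ltW.
have lu : l (u k) @[k --> \oo] --> within Lambda (nbhs (l s)).
  have lus : l (u k) @[k --> \oo] --> l s.
    by apply: continuous_cvg; [exact: lc|exact: us].
  move=> A hA.
  have luA : \forall k \near \oo, Lambda (l (u k)) -> A (l (u k)) :=
    lus _ hA.
  change (\forall k \near \oo, A (l (u k))).
  by apply: filterS luA => k; apply; exact: Ll.
have := cvg_comp _ _ lu (cl (l s) (Ll s s0) f f_cont f_bd).
rewrite (mE _ (Ll s s0)).
have -> : ((fun l => 'E_P[f \o M l t1])%E \o (l \o u)) =
  fun k => (\int[P]_w (ramp n x (ln (M (l (u k)) t w)))%:E)%E.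
  by apply/funext => k /=; rewrite mE//; exact: Ll.
move=> cE; apply: fine_cvg; rewrite fineK//.
apply: integral_le1_fin_num => [|w]; last by rewrite ramp_ge0 ramp_le1.
apply: (measurableT_comp (measurable_ramp n x)).
exact: (measurableT_comp (@measurable_ln R)).
Qed.

End scaling_factors.

Section multifractal_levy.
Context (R : realType) (d : measure_display) (Om : measurableType d).
Context (P : probability Om R) (T Lambda S : set R).
Context (X : R -> {RV P >-> R}) (M : R -> R -> {RV P >-> R}).
Context (hST : S `<=` T) (hX : multifractal T Lambda S X M).
Context (hLambdaS : forall l t, Lambda l -> S t -> S (l * t)).
Context (hXS : exists2 t : R, S t & (0 < P [set w | X t w != 0%R])%E).
Context (hq : (0 < qbar P T X)%E).
Context (hM : exists2 t : R, S t & continuous_in_law P Lambda (fun l => M l t)).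
Context (d' : measure_display) (Om' : measurableType d').
Context (P' : probability Om' R) (L : R -> {RV P' >-> R}).

(** Both cases of the theorem at once: [l] is a continuous one-parameter
    semigroup of scales, [expR (- s)] or [expR s]. *)
Lemma multifractal_levy_scaling (l : R -> R) (t : R) :
  (forall s : R, 0 <= s -> Lambda (l s)) ->
  (forall s u, l (s + u) = l s * l u) -> continuous l -> S t ->
  levy_process L -> eq_law P' (L 1) P (fun w => ln (M (l 1) t w)) ->
  forall s : R, 0 <= s -> eq_law P' (L s) P (fun w => ln (M (l s) t w)).
Proof.
move=> Ll lD lc St hL L1; have [t0 St0 X0] := hXS.
have [q1 q10 Xq1] := qbar_moment hq.
have Xq0 q : 0 < q < q1 -> (0 < \int[P]_w (`|X t0 w| `^ q)%:E)%E.
  by move=> /andP[q0 _]; exact: abs_moment_gt0.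
have Xqy q v : 0 < q < q1 -> S v -> (\int[P]_w (`|X v w| `^ q)%:E < +oo)%E.
  by move=> qq Sv; apply: abs_moment_lty qq (Xq1 _ _) => //; exact: hST.
apply: (@levy_eq_law_family _ _ _ _ _ P P' L (fun s w => ln (M (l s) t w)) q1)
  => //.
- by move=> s; exact: (measurableT_comp (@measurable_ln R)).
- move=> q qq; split=> [s|s u s0 u0].
    by apply: integral_ge0 => w _; rewrite lee_fin expR_ge0.
  have Ls := Ll s (ltW s0); have Lu := Ll u (ltW u0).
  have Lsu := Ll (s + u) (ltW (addr_gt0 s0 u0)).
  have := @log_factor_mgfM _ _ _ _ _ _ _ _ _ hST hX q t0 St0 (Xq0 q qq)
    (Xqy q t0 qq St0) (l s) (l u) t Ls Lu _ St (hLambdaS Lu St0).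
  by rewrite -lD; exact.
- move=> q s qq s0; have Ls := Ll s (ltW s0).
  apply: (log_factor_mgf_lty hST hX St0 (Xq0 q qq) Ls St).
  by apply: Xqy => //; exact: hLambdaS.
- by move=> n x s u n0 s0 u0 us; exact: (log_factor_ramp_cvg hX hM St n0 Ll lc).
Qed.

End multifractal_levy.

(** * The law of the scaling factors *)

Theorem proposition3p2 (R : realType)
  (d : measure_display) (Om : measurableType d) (P : probability Om R)
  (T Lambda S : set R)
  (hT : time_set T)
  (hST : S `<=` T)
  (hLambda : Lambda = `]0, 1]%classic \/ Lambda = `[1, +oo[%classic)
  (hLambdaS : forall l t, Lambda l -> S t -> S (l * t))
  (X : R -> {RV P >-> R}) (M : R -> R -> {RV P >-> R})
  (hXT : not_identically_null P T X)
  (hXS : exists2 t : R, S t & (0 < P [set w | X t w != 0%R])%E)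
  (hX : multifractal T Lambda S X M)
  (hq : (0 < qbar P T X)%E)
  (hM : exists2 t : R, S t & continuous_in_law P Lambda (fun l => M l t))
  (t : R) (ht : S t)
  (d' : measure_display) (Om' : measurableType d') (P' : probability Om' R)
  (L : R -> {RV P' >-> R})
  (hL : levy_process L)
  (hL1d : Lambda = `]0, 1]%classic ->
    eq_law P' (L 1) P (fun w => ln (M (expR (- 1)) t w)))
  (hL1u : Lambda = `[1, +oo[%classic ->
    eq_law P' (L 1) P (fun w => ln (M (expR 1) t w))) :
  forall s : R, 0 <= s ->
    (Lambda = `]0, 1]%classic ->
      eq_law P' (L s) P (fun w => ln (M (expR (- s)) t w))) /\
    (Lambda = `[1, +oo[%classic ->
      eq_law P' (L s) P (fun w => ln (M (expR s) t w))).
Proof.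
move=> s s0; split=> HL.
- apply: (multifractal_levy_scaling hST hX hLambdaS hXS hq hM
    (l := fun s => expR (- s)) _ _ _ ht hL (hL1d HL) s0).
  + move=> u u0; rewrite HL /= in_itv /= expR_gt0 /=.
    by rewrite -[leRHS]expR0 ler_expR oppr_le0.
  + by move=> u v; rewrite opprD expRD.
  + move=> u; apply: (continuous_comp (f := -%R)); first exact: oppr_continuous.
    exact: continuous_expR.
- apply: (multifractal_levy_scaling hST hX hLambdaS hXS hq hM
    (l := expR) _ _ _ ht hL (hL1u HL) s0).
  + by move=> u u0; rewrite HL /= in_itv /= andbT -[leLHS]expR0 ler_expR.
  + exact: expRD.
  + exact: continuous_expR.
Qed.
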